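(* There exists $m_0$ such that the following holds for every integer $m\ge m_0$. Let $\mathcal H$ be a simple $(m-1)$-uniform hypergraph on $2m$ vertices, let $C$ be a Hamiltonian Berge cycle in $\mathcal H$, and let $f\in E(\mathcal H)\setminus E(C)$. Then the subhypergraph with edge set $E(C)\cup\{f\}$ is Berge-pancyclic, i.e. it contains Berge cycles of every length $2,3,\dots,2m$.
   Context: All hypergraphs are finite and simple: the edge family consists of distinct subsets of the vertex set. A Berge cycle of length $\ell\ge 2$ is an alternating sequence $x_0h_0x_1h_1\cdots x_{\ell-1}h_{\ell-1}x_0$ with distinct vertices $x_i$, distinct hyperedges $h_i$, and $\{x_i,x_{i+1}\}\subseteq h_i$ for every $i$ (indices modulo $\ell$); its edge set is $E(C)=\{h_0,\dots,h_{\ell-1}\}$. It is Hamiltonian if it contains every vertex. An $n$-vertex hypergraph is Berge-pancyclic if it contains Berge cycles of every length $2,3,\dots,n$. The subhypergraph with a given edge set keeps the same vertex set. *)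

(* Defs.v *)
From mathcomp Require Import all_boot.

Set Implicit Arguments.
Unset Strict Implicit.
Unset Printing Implicit Defensive.

(* A simple hypergraph on the vertex set T is its set of edges E : {set {set T}},
   so that all subhypergraphs keep the vertex set T. *)

Definition uniform (T : finType) (k : nat) (E : {set {set T}}) : Prop :=
  forall e, e \in E -> #|e| = k.

(* The sequence x_0 h_0 x_1 h_1 ... x_(l-1) h_(l-1) x_0; ordS is the successor
   modulo l. *)
Record berge_cycle (T : finType) (E : {set {set T}}) (l : nat)
    (x : 'I_l -> T) (h : 'I_l -> {set T}) : Prop := BergeCycle {
  berge_length : 2 <= l;
  berge_vertices_inj : injective x;
  berge_edges_inj : injective h;
  berge_edges_mem : forall i, h i \in E;
  berge_incidence : forall i, [set x i; x (ordS i)] \subset h i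
}.

Definition cycle_edges (T : finType) (l : nat) (h : 'I_l -> {set T})
  : {set {set T}} := [set h i | i : 'I_l].

Definition hamiltonian (T : finType) (l : nat) (x : 'I_l -> T) : Prop :=
  forall v : T, exists i, x i = v.

Definition berge_pancyclic (T : finType) (E : {set {set T}}) : Prop :=
  forall l, 2 <= l <= #|T| ->
    exists (x : 'I_l -> T) (h : 'I_l -> {set T}), berge_cycle E x h.

(* Main.v *)
Require Import Defs.
From Stdlib Require Import Classical_Prop.
From mathcomp Require Import all_boot.
From mathcomp Require Import zify.

Set Implicit Arguments.
Unset Strict Implicit.
Unset Printing Implicit Defensive.

(** Number the vertices of [C] cyclically as [v 1, ..., v n] with [n = 2 m], and
suppose that no Berge cycle of length [d + 1] exists.  Only very simple cycles are
excluded: one arc of [C] closed by one hyperedge, and two arcs joined by two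
hyperedges.  One arc closed by [f] shows that the set [F] of positions of [f] is
disjoint from [F + d]; as [2 |F| = n - 2], the two sets miss only two positions,
so "not in [F + d]" almost means "in [F]".  If [F] contains position 1, the
two-arc cycles through [f] and the free hyperedge [h] between positions [n] and 1
then determine [h] up to boundedly many positions.
- If [f] has no two consecutive vertices, [F] is almost alternating, and the
  hyperedges on both sides of a vertex of [f] together give a cycle of length
  [d + 1].
- Otherwise, comparing [h] with the constraints coming from a second position
  [s + 1] of [F] shows that [F] is almost invariant under a decreasing shift by [s]
  on [1, d] and an increasing one on [d + 2, n + 1].  Taking [s = 1] bounds the
  number of runs of [F], and adding [s = 8] forces [F] to be an interval of length
  about [m] up to boundedly many positions; also [d] is about [m].  The hyperedge of
  [C] opposite to this interval then avoids almost all of the interval and almost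
  half of its complement, which leaves fewer than [m - 1] vertices for it. *)

(** * Berge cycles made of one or two arcs *)

Lemma eqn_mod_window n a i j : a <= i < a + n -> a <= j < a + n ->
  (i == j %[mod n]) = (i == j).
Proof.
wlog le_ij : i j / i <= j => [hw hi hj|hi hj].
  by case/orP: (leq_total i j) => h; [|rewrite eq_sym [RHS]eq_sym]; apply: hw.
rewrite eq_sym [RHS]eq_sym eqn_mod_dvd //; apply/idP/eqP => [|->].
  have [/eqP|ji] := posnP (j - i); first by lia.
  by move=> /(dvdn_leq ji); lia.
by rewrite subnn.
Qed.

Section BergeCycles.
Variables (T : finType) (E : {set {set T}}).

Definition has_cycle l :=
  exists (x : 'I_l -> T) (h : 'I_l -> {set T}), berge_cycle E x h.

(** A Berge cycle is coded as a sequence of pairs: each vertex comes with the hyperedge through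
    which it is entered. *)
Definition link (p q : {set T} * T) := (p.2 \in q.1) && (q.2 \in q.1).

Lemma has_cycle_seq (s : seq ({set T} * T)) :
  1 < size s -> uniq (map fst s) -> uniq (map snd s) ->
  all (mem E) (map fst s) -> cycle link s -> has_cycle (size s).
Proof.
case: s => [//|p0 s0]; set s := p0 :: s0 => s1 uf us sE.
rewrite (cycle_path p0) => /(pathP p0) hp.
pose l := size s.
have lnk (i : 'I_l) : link (nth p0 s i) (nth p0 s (ordS i)).
  have := hp (ordS i) (ltn_ord _); rewrite /=.
  have li := ltn_ord i.
  have [h|h] : i.+1 < l \/ i.+1 = l by lia.
    by rewrite modn_small.
  have -> : (i : nat) = (size s).-1 by have := congr1 predn h.
  by rewrite modnn nth_last.
(* The hyperedge leaving a vertex is stored with the next vertex, hence [ordS]. *)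
exists (fun i => (nth p0 s i).2), (fun i => (nth p0 s (ordS i)).1); split=> //.
- move=> i j; rewrite -!(nth_map p0 p0.2 snd) // => /eqP.
  by rewrite nth_uniq ?size_map // => /eqP/val_inj.
- move=> i j; rewrite -!(nth_map p0 p0.1 fst) // => /eqP.
  by rewrite nth_uniq ?size_map // => /eqP/val_inj/ordS_inj.
- by move=> i; apply: (allP sE); rewrite -(nth_map p0 p0.1 fst) // mem_nth ?size_map.
- move=> i; have /andP[h1 h2] := lnk i.
  by apply/subsetP => u; rewrite !inE => /orP[]/eqP->.
Qed.

Variable n : nat.

(* [v i] and [e i] are [n]-periodic in [i : nat]; [e i] joins [v i] to [v i.+1]. *)
Record ham_plus (v : nat -> T) (e : nat -> {set T}) (f : {set T}) : Prop := HamPlus {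
  hp_v : forall i j, (v i == v j) = (i == j %[mod n]);
  hp_e : forall i j, (e i == e j) = (i == j %[mod n]);
  hp_in : forall i, v i \in e i;
  hp_inS : forall i, v i.+1 \in e i;
  hp_f : forall i, e i != f;
  hp_eE : forall i, e i \in E;
  hp_fE : f \in E }.

(** Lets a chosen vertex of [f] be moved to position 1, or a chosen hyperedge to index 0. *)
Lemma ham_plus_shift v e f c : ham_plus v e f ->
  ham_plus (fun i => v (c + i)) (fun i => e (c + i)) f.
Proof.
case=> hv he ? h ? ? ?; split=> // i; do ?[by move=> j; rewrite ?hv ?he eqn_modDl].
by rewrite addnS.
Qed.

Section Arcs.
Variables (v : nat -> T) (e : nat -> {set T}) (f : {set T}).
Hypothesis hp : ham_plus v e f.

Let v_in := hp_in hp.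
Let v_inS := hp_inS hp.

(** The starting vertex, [v a] for [arc] and [v (a + k)] for the reversed [rarc], is left out: it
    belongs to the preceding pair. *)
Definition arc a k := [seq (e i, v i.+1) | i <- iota a k].
Definition rarc a k := [seq (e i, v i) | i <- rev (iota a k)].

Lemma arcS a k : arc a k.+1 = (e a, v a.+1) :: arc a.+1 k.
Proof. by []. Qed.

Lemma rarcS a k : rarc a k.+1 = (e (a + k), v (a + k)) :: rarc a k.
Proof. by rewrite /rarc -(addn1 k) iotaD rev_cat. Qed.

Lemma path_arc g a k : path link (g, v a) (arc a k).
Proof.
by elim: k g a => [//|k IH] g a; rewrite arcS /= IH /link /= v_in v_inS.
Qed.

Lemma last_arc g a k : (last (g, v a) (arc a k)).2 = v (a + k).
Proof. by elim: k g a => [|k IH] g a; rewrite ?addn0 // arcS /= IH addnS. Qed.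

Lemma path_rarc g a k : path link (g, v (a + k)) (rarc a k).
Proof.
by elim: k g => [//|k IH] g; rewrite rarcS /= IH /link /= v_in addnS v_inS.
Qed.

Lemma last_rarc g a k : (last (g, v (a + k)) (rarc a k)).2 = v a.
Proof. by elim: k g => [|k IH] g; rewrite ?addn0 // rarcS /= IH. Qed.

Lemma map_v_uniq (s : seq nat) b : {in s, forall i, b <= i < b + n} -> uniq s ->
  uniq (map v s).
Proof.
move=> hs us; rewrite map_inj_in_uniq // => i j hi hj /eqP.
by rewrite (hp_v hp) (eqn_mod_window (hs _ hi) (hs _ hj)) => /eqP.
Qed.

Lemma map_e_uniq (s : seq nat) b : {in s, forall i, b <= i < b + n} -> uniq s ->
  uniq (map e s).
Proof.
move=> hs us; rewrite map_inj_in_uniq // => i j hi hj /eqP.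
by rewrite (hp_e hp) (eqn_mod_window (hs _ hi) (hs _ hj)) => /eqP.
Qed.

(** The arc from [v a] to [v (a + k)] has [k.+1] distinct vertices because [k < n], and [g] closes
    it. *)
Lemma one_arc g a k : 0 < k < n -> g \in E -> (forall i, a <= i < a + k -> e i != g) ->
  v a \in g -> v (a + k) \in g -> has_cycle k.+1.
Proof.
move=> /andP[k0 kn] gE gf ga gk.
have -> : k.+1 = size ((g, v a) :: arc a k) by rewrite /= size_map size_iota.
apply: has_cycle_seq => /=.
- by rewrite size_map size_iota.
- rewrite -map_comp /=; apply/andP; split.
    apply/negP => /mapP[i]; rewrite mem_iota => hi hg.
    by have := gf i hi; rewrite hg eqxx.
  by apply: (map_e_uniq (b := a)) (iota_uniq _ _) => i; rewrite mem_iota; lia.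
- rewrite -map_comp /=.
  have : uniq (map v (iota a k.+1)).
    by apply: (map_v_uniq (b := a)) (iota_uniq _ _) => i; rewrite mem_iota; lia.
  by rewrite /= (iotaDl 1 a) -map_comp.
- rewrite gE -map_comp; apply/allP => _ /mapP[i _ ->] /=; exact: (hp_eE hp).
- by rewrite rcons_path path_arc /link /= last_arc ga gk.
Qed.

Section TwoArcs.
Variables (g g' : {set T}) (a k c j : nat).
Hypotheses (kc : a + k < c) (jn : c + j < a + n).
Hypotheses (gE : g \in E) (gE' : g' \in E) (gg' : g != g').
Hypothesis gf : forall i, (a <= i < a + k) || (c <= i < c + j) ->
  (e i != g) && (e i != g').

Lemma two_arcs_edges_uniq :
  uniq (g' :: [seq e i | i <- iota a k] ++ g :: [seq e i | i <- iota c j]).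
Proof.
have hg : (g \notin map e (iota a k ++ iota c j)) && (g' \notin map e (iota a k ++ iota c j)).
  apply/andP; split; apply/negP => /mapP[i]; rewrite mem_cat !mem_iota => hi h;
  by have /andP[] := gf hi; rewrite -h eqxx.
rewrite -cat_cons uniq_catC /= mem_cat inE map_cat negb_or in hg *.
rewrite cat_uniq /= in hg *; case/andP: hg; rewrite !mem_cat !negb_or.
move=> /andP[-> g2] /andP[g3 g4]; rewrite (negbTE g2) gg' g3 g4 /=.
have : uniq (map e (iota a k ++ iota c j)).
  apply: (map_e_uniq (b := a)) => [i|]; first by rewrite mem_cat !mem_iota; lia.
  rewrite cat_uniq !iota_uniq andbT /=; apply/hasPn => i; rewrite !mem_iota; lia.
rewrite map_cat cat_uniq => /and3P[-> h ->]; rewrite /= ?andbT.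
by rewrite has_sym.
Qed.

Lemma two_arcs_vertices_uniq :
  uniq (map v (iota a k.+1 ++ iota c j.+1)).
Proof.
apply: (map_v_uniq (b := a)) => [i|]; first by rewrite mem_cat !mem_iota; lia.
have : a + k.+1 <= c by lia.
move: k.+1 j.+1 => k1 j1 ac.
rewrite cat_uniq !iota_uniq andbT /=; apply/hasPn => i; rewrite !mem_iota; lia.
Qed.

Lemma two_arcs_edges_E :
  all (mem E) (g' :: [seq e i | i <- iota a k] ++ g :: [seq e i | i <- iota c j]).
Proof.
have h s : all (mem E) (map e s) by apply/allP => _ /mapP[i _ ->]; exact: (hp_eE hp).
by rewrite /= gE' all_cat /= gE !h.
Qed.

(** Both arcs are traversed forwards: [g] leads from the end of the first to the start of the
    second, [g'] from the end of the second back to the start of the first. *)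
Lemma two_arcs_par : v (a + k) \in g -> v c \in g -> v (c + j) \in g' -> v a \in g' ->
  has_cycle (k + j).+2.
Proof.
move=> h1 h2 h3 h4.
pose s := (g', v a) :: arc a k ++ (g, v c) :: arc c j.
have -> : (k + j).+2 = size s by rewrite /= size_cat /= !size_map !size_iota; lia.
have sf : map fst s = g' :: [seq e i | i <- iota a k] ++ g :: [seq e i | i <- iota c j].
  by rewrite /= map_cat /= -!map_comp.
have ss : map snd s = map v (iota a k.+1 ++ iota c j.+1).
  by rewrite /= !map_cat /= -!map_comp (iotaDl 1 a) (iotaDl 1 c) -!map_comp.
apply: has_cycle_seq; rewrite ?sf ?ss.
- by rewrite /= size_cat /= addnS.
- exact: two_arcs_edges_uniq.
- exact: two_arcs_vertices_uniq.
- exact: two_arcs_edges_E.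
- rewrite /= rcons_cat cat_path path_arc /= rcons_path path_arc /link /=.
  by rewrite !last_arc h1 h2 h3 h4.
Qed.

(** The second arc is traversed backwards: [g] joins the two ends, [g'] the two starts. *)
Lemma two_arcs_anti : v (a + k) \in g -> v (c + j) \in g -> v c \in g' -> v a \in g' ->
  has_cycle (k + j).+2.
Proof.
move=> h1 h2 h3 h4.
pose s := (g', v a) :: arc a k ++ (g, v (c + j)) :: rarc c j.
have -> : (k + j).+2 = size s.
  by rewrite /= size_cat /= !size_map size_rev !size_iota; lia.
have sf : perm_eq (map fst s)
    (g' :: [seq e i | i <- iota a k] ++ g :: [seq e i | i <- iota c j]).
  rewrite /= map_cat /= -!map_comp perm_cons perm_cat2l perm_cons.
  by rewrite (eq_map (g := e)) // perm_map // perm_rev.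
have ss : perm_eq (map snd s) (map v (iota a k.+1 ++ iota c j.+1)).
  rewrite -[k.+1]/(1 + k) -(addn1 j) !iotaD map_cat /= !map_cat /= -!map_comp.
  rewrite perm_cons (addnC a) (iotaDl 1 a) -map_comp perm_cat2l -[_ :: _]cat1s perm_catC.
  by rewrite perm_cat2r perm_map // perm_rev.
apply: has_cycle_seq.
- by rewrite /= size_cat /= addnS.
- by rewrite (perm_uniq sf) two_arcs_edges_uniq.
- by rewrite (perm_uniq ss) two_arcs_vertices_uniq.
- by rewrite (perm_all _ sf) two_arcs_edges_E.
- rewrite /= rcons_cat cat_path path_arc /= rcons_path path_rarc /link /=.
  by rewrite last_arc last_rarc h1 h2 h3 h4.
Qed.

End TwoArcs.
End Arcs.
End BergeCycles.

(** * Counting on intervals *)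

Definition cnt (P : pred nat) a b := \sum_(a <= i < b) (P i : nat).

Section Counting.
Implicit Types (P Q R : pred nat) (a b c : nat).

Lemma cnt_sub P Q a b : (forall i, a <= i < b -> P i -> Q i) -> cnt P a b <= cnt Q a b.
Proof.
move=> h; rewrite /cnt big_nat_cond [X in _ <= X]big_nat_cond.
apply: leq_sum => i /andP[/h]; by case: (P i) => // ->.
Qed.

Lemma eq_cnt P Q a b : (forall i, a <= i < b -> P i = Q i) -> cnt P a b = cnt Q a b.
Proof. by move=> h; apply: eq_big_nat => i /h ->. Qed.

Lemma cntU P Q a b : cnt (fun i => P i || Q i) a b <= cnt P a b + cnt Q a b.
Proof.
by rewrite /cnt -big_split leq_sum // => i _; case: (P i); case: (Q i).
Qed.

Lemma cnt_subU P Q R a b : (forall i, a <= i < b -> P i -> Q i || R i) ->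
  cnt P a b <= cnt Q a b + cnt R a b.
Proof. by move=> h; apply: leq_trans (cnt_sub h) (cntU _ _ _ _). Qed.

Lemma cnt_diff P Q a b :
  cnt P a b + cnt (fun i => Q i && ~~ P i) a b = cnt Q a b + cnt (fun i => P i && ~~ Q i) a b.
Proof.
by rewrite /cnt -!big_split; apply: eq_bigr => i _; case: (P i); case: (Q i).
Qed.

Lemma cntC P a b : cnt P a b + cnt (fun i => ~~ P i) a b = b - a.
Proof.
rewrite /cnt -big_split -[RHS]muln1 -sum_nat_const_nat.
by apply: eq_bigr => i _; case: (P i).
Qed.

Lemma cnt_size P a b : cnt P a b <= b - a.
Proof. by rewrite -(cntC P) leq_addr. Qed.

Lemma cnt_full P a b : (forall i, a <= i < b -> P i) -> cnt P a b = b - a.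
Proof.
move=> hP; rewrite -(cntC P a b) [X in _ = _ + X](_ : _ = 0) ?addn0 //.
by rewrite /cnt big_nat big1 // => i /hP ->.
Qed.

Lemma cnt_cover P Q a b : (forall i, a <= i < b -> P i || Q i) ->
  b - a <= cnt P a b + cnt Q a b.
Proof.
move=> h; rewrite -(@cnt_full xpredT a b) //.
by apply: cnt_subU => i /h.
Qed.

Lemma cnt_cat P a b c : a <= b -> b <= c -> cnt P a c = cnt P a b + cnt P b c.
Proof. exact: big_cat_nat. Qed.

Lemma cnt1 P a : cnt P a a.+1 = P a.
Proof. exact: big_nat1. Qed.

Lemma cnt_nil P a b : b <= a -> cnt P a b = 0.
Proof. by move=> h; rewrite /cnt big_geq. Qed.

Lemma cnt_shift P s a b : cnt (fun i => P (i + s)) a b = cnt P (a + s) (b + s).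
Proof. by rewrite /cnt big_addn addnK. Qed.

Lemma cnt_wide P a b a' b' : a' <= a -> b <= b' -> cnt P a b <= cnt P a' b'.
Proof.
move=> ha hb; have [ba|ab] := leqP b a; first by rewrite cnt_nil.
by rewrite (cnt_cat P ha) ?(cnt_cat P (ltnW ab) hb); lia.
Qed.

Lemma cnt_exists P a b : 0 < cnt P a b -> exists2 i, a <= i < b & P i.
Proof.
rewrite /cnt => h; have [/hasP[i]|/hasPn no] := boolP (has P (index_iota a b)).
  by rewrite mem_index_iota => ? ?; exists i.
by move: h; rewrite big_nat big1 // => i; rewrite -mem_index_iota => /no/negbTE->.
Qed.

Lemma cnt_gt0 P a b i : a <= i < b -> P i -> 0 < cnt P a b.
Proof.
move=> hi Pi; apply: leq_trans (cnt_wide (a := i) (b := i.+1) P _ _); try lia.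
by rewrite cnt1 Pi.
Qed.

Lemma cnt_exists_diff P Q a b : cnt Q a b < cnt P a b ->
  exists2 i, a <= i < b & P i && ~~ Q i.
Proof.
move=> h; apply: (@cnt_exists (fun i => P i && ~~ Q i)).
by have := cnt_diff Q P a b; lia.
Qed.

Lemma cnt_period P n a : (forall i, P (i + n) = P i) -> cnt P a (a + n) = cnt P 0 n.
Proof.
move=> per; have h : cnt P n (a + n) = cnt P 0 a.
  by rewrite -[n in cnt _ n]add0n -cnt_shift; apply: eq_cnt => i _; rewrite per.
have h1 := cnt_cat P (leq0n a) (leq_addr n a).
by apply/eqP; rewrite -(eqn_add2l (cnt P 0 a)) -h1 (cnt_cat P (leq0n n) (leq_addl a n)) h addnC.
Qed.

Lemma cnt_reflect P N a b : b <= N.+1 ->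
  cnt (fun i => P (N - i)) a b = cnt P (N.+1 - b) (N.+1 - a).
Proof.
have [ba _|ab] := leqP b a; first by rewrite !cnt_nil // leq_sub2l.
elim: b ab => [//|b IH]; rewrite ltnS leq_eqVlt => /predU1P[<-|ab] hb.
  by rewrite cnt1 subSS subSn // cnt1.
rewrite (cnt_cat _ (ltnW ab) (leqnSn b)) cnt1 IH // ?(ltnW hb) // addnC subSS.
rewrite (subSn (hb : b <= N)) [RHS](cnt_cat P (leqnSn (N - b))) ?cnt1 //.
by move: ab hb; clear; lia.
Qed.

Lemma cnt_windowU P k a b :
  cnt (fun i => has (fun j => P (i + j)) (iota 0 k)) a b <= k * cnt P a (b + k.-1).
Proof.
elim: k => [|k IH]; first by rewrite /cnt big1.
have -> : k.+1 * cnt P a (b + k.+1.-1) = k * cnt P a (b + k) + cnt P a (b + k).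
  by rewrite mulSnr.
have h : cnt (fun i => P (i + k)) a b <= cnt P a (b + k).
  by rewrite cnt_shift cnt_wide // leq_addr.
apply: leq_trans (_ : _ <= k * cnt P a (b + k.-1) + cnt (fun i => P (i + k)) a b) _.
  apply: leq_trans (leq_add IH (leqnn _)); apply: cnt_subU => i _.
  by rewrite -addn1 iotaD has_cat /= orbF add0n.
by apply: leq_add h; rewrite leq_mul2l cnt_wide ?orbT // leq_add2l leq_pred.
Qed.

End Counting.

(** * Predicates that are almost monotone *)

Section Threshold.
Variable P : pred nat.

Definition rise y := P y && ~~ P (y - 1).

(** Without a rise, [P] can only switch off along the block, so equal values at its ends force it to
    be constant. *)
Lemma flat_block a k : cnt rise a.+1 (a + k).+1 = 0 -> P (a + k) = P a ->
  forall y, a <= y < a + k -> P y = P a.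
Proof.
move=> no Pk y /andP[ay yk].
have dec i j : a <= i -> i + j <= a + k -> P (i + j) -> P i.
  move=> ai; elim: j => [|j IH] hij; first by rewrite addn0.
  move=> Pij; apply: IH; first by rewrite addnS in hij; exact: ltnW.
  apply/negPn/negP => nP.
  have : rise (i + j.+1) by rewrite /rise Pij addnS subn1.
  by move/(cnt_gt0 (a := a.+1) (b := (a + k).+1)); rewrite no => /(_ _)/implyP; lia.
apply/idP/idP => [Py|Pa].
  by apply: (dec a (y - a)) => //; rewrite subnKC // ltnW.
by apply: (dec y (a + k - y)) => //; rewrite subnKC ?Pk // ltnW.
Qed.

(** A block without a rise is constantly [b]; any other block costs at most its length [s] and
    contains a rise. *)
Lemma flat_blocks b s a k : (forall j, j <= k -> P (a + j * s) = b) ->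
  cnt (fun y => P y != b) a (a + k * s) <= s * cnt rise a.+1 (a + k * s).+1.
Proof.
elim: k => [|k IH] hP; first by rewrite cnt_nil // addn0.
have e1 : a + k.+1 * s = a + k * s + s by rewrite mulSnr addnA.
rewrite e1 (cnt_cat _ (leq_addr (k * s) a) (leq_addr s _)).
rewrite (@cnt_cat rise a.+1 (a + k * s).+1) ?ltnS ?leq_addr //.
rewrite mulnDr; apply: leq_add; first by apply: IH => j hj; apply: hP; exact: leqW.
have [h0|hpos] := posnP (cnt rise (a + k * s).+1 (a + k * s + s).+1).
  have hk : P (a + k * s) = b by apply: hP.
  have hk' : P (a + k * s + s) = P (a + k * s) by rewrite hk -e1 hP.
  rewrite h0 muln0 leqn0 /cnt big_nat big1 // => i hi.
  by rewrite (flat_block h0 hk' hi) hk eqxx.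
by apply: leq_trans (cnt_size _ _ _) _; rewrite addKn leq_pmulr.
Qed.

(** Pigeonhole: fewer than [s] exceptions cannot meet all [s] residue classes. *)
Lemma good_residue s L : 0 < s -> cnt (fun y => P y && ~~ P (y - s)) s L < s ->
  exists2 r, r < s & forall y, s <= y < L -> y %% s = r -> P y -> P (y - s).
Proof.
move=> s0; set exc := (fun y => _) => hs.
have [/existsP[r /forallP hr]|] := boolP [exists r : 'I_s, [forall y : 'I_L,
    (s <= y) && (y %% s == r) ==> ~~ exc y]].
  exists r => // y /andP[sy yL] /eqP yr Py; apply/negPn/negP => nP.
  by have := hr (Ordinal yL); rewrite /= sy yr /exc Py nP.
rewrite negb_exists => /forallP h; move: hs; rewrite ltnNge => /negP[].
have -> : cnt exc s L = \sum_(r < s) cnt (fun y => exc y && (y %% s == r)) s L.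
  rewrite /cnt exchange_big /=; apply: eq_bigr => y _.
  rewrite (bigD1 (Ordinal (ltn_pmod y s0))) //= eqxx andbT big1 ?addn0 // => r.
  by rewrite -val_eqE /= eq_sym => /negbTE->; rewrite andbF.
rewrite -[X in X <= _]card_ord -sum1_card leq_sum // => r _.
have := h r; rewrite negb_forall => /existsP[y]; rewrite negb_imply negbK.
move=> /andP[/andP[sy yr] ey].
by apply: (cnt_gt0 (i := y)); rewrite ?sy ?ltn_ord ?ey.
Qed.

(* Along a residue class mod [s] without exceptions, [P] switches at most once, from
   true to false; a block of [s] positions on which [P] differs from both of its ends
   contains a rise, and rises are few. *)
Lemma threshold s k L : 0 < s ->
  cnt (fun y => P y && ~~ P (y - s)) s L < s -> cnt rise 1 L <= k ->
  exists t, [/\ t <= L, cnt (fun y => ~~ P y) 0 t <= s * k.+2 & cnt P t L <= s * k.+1].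
Proof.
move=> s0 hs hk; have [r rs hr] := good_residue s0 hs.
have step j : r + j.+1 * s < L -> P (r + j.+1 * s) -> P (r + j * s).
  move=> jL; have -> : r + j * s = r + j.+1 * s - s by rewrite mulSnr addnA addnK.
  apply: hr; first by rewrite jL andbT mulSnr addnA leq_addl.
  by rewrite addnC modnMDl modn_small.
have rise_le a b : 0 < a -> b <= L -> s * cnt rise a b <= s * k.
  by move=> ha hb; rewrite leq_mul2l (leq_trans _ hk) ?orbT // cnt_wide.
(* Before the first stop, [P] holds on the class; after a stop inside [0, L), [step] keeps it
   false. *)
pose stop j := (L <= r + j * s) || ~~ P (r + j * s).
have ex_stop : exists j, stop j.
  by exists L; rewrite /stop (leq_trans (leq_pmulr L s0)) ?leq_addl.
case: (ex_minnP ex_stop) => j0 sj0 minj0.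
have before j : j < j0 -> (r + j * s < L) && P (r + j * s).
  by rewrite ltnNge => /(contraNN (minj0 j)); rewrite /stop negb_or negbK ltnNge.
(* The first [r < s] positions and the last block cost at most [s] each, the blocks between them at
   most [s * k]. *)
have ones b : b <= r + j0 * s -> b <= L -> cnt (fun y => ~~ P y) 0 b <= s * k.+2.
  move=> b1 b2; case: j0 before b1 {sj0 minj0} => [|j] before b1.
    apply: leq_trans (cnt_size _ _ _) _; rewrite subn0 (leq_trans b1) // addn0.
    by rewrite (leq_trans (ltnW rs)) // leq_pmulr.
  have /andP[jL _] := before j (ltnSn j).
  apply: leq_trans (cnt_wide _ (leqnn 0) b1) _.
  rewrite (cnt_cat _ (leq0n r) (leq_addr _ _)) mulSnr addnA.
  rewrite (cnt_cat _ (leq_addr (j * s) r) (leq_addr s _)).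
  have h1 := cnt_size (fun y => ~~ P y) 0 r.
  have h2 := cnt_size (fun y => ~~ P y) (r + j * s) (r + j * s + s).
  have h3 : cnt (fun y => ~~ P y) r (r + j * s) <= s * k.
    apply: leq_trans (rise_le r.+1 (r + j * s).+1 _ _) => //.
    apply: leq_trans (flat_blocks (b := true) _).
      by apply: cnt_sub => i _; case: (P i).
    by move=> i hi; have /andP[] := before i hi.
  by move: h1 h2 h3 rs; rewrite !mulnS; clear; lia.
have [Lj|jL] := leqP L (r + j0 * s).
  by exists L; split => //; [exact: ones|rewrite cnt_nil].
exists (r + j0 * s); split; [exact: ltnW|by apply: ones (ltnW jL)|].
have nP0 : ~~ P (r + j0 * s) by move: sj0; rewrite /stop leqNgt jL.
have zero j : r + (j0 + j) * s < L -> P (r + (j0 + j) * s) = false.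
  elim: j => [_|j IH]; first by rewrite addn0 (negbTE nP0).
  rewrite addnS => hj; apply/negP => /(step _ hj); rewrite IH //.
  by apply: leq_ltn_trans hj; rewrite leq_add2l leq_mul2r leqnSn orbT.
(* [a + q * s] is the last member of the class below [L]; at most one more block follows it. *)
set a := r + j0 * s; set q := (L - a.+1) %/ s.
have qa : a + q * s < L.
  by have := leq_divM (L - a.+1) s; rewrite -/q /a; move: jL; clear; lia.
have qb : L <= a + q * s + s.
  by have := ltn_ceil (L - a.+1) s0; rewrite -/q mulSnr; move: jL; rewrite -/a; clear; lia.
apply: leq_trans (cnt_wide _ (leqnn a) qb) _.
rewrite (cnt_cat _ (leq_addr (q * s) a) (leq_addr s _)) mulnS addnC.
apply: leq_add; first by rewrite (leq_trans (cnt_size _ _ _)) // addKn.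
apply: leq_trans (rise_le a.+1 (a + q * s).+1 _ _) => //.
apply: leq_trans (flat_blocks (b := false) _).
  by apply: cnt_sub => i _; case: (P i).
move=> j hj; have -> : a + j * s = r + (j0 + j) * s by rewrite mulnDl addnA.
apply: zero; rewrite mulnDl addnA; apply: leq_ltn_trans qa.
by rewrite leq_add2l leq_mul2r hj orbT.
Qed.

(** * Predicates without long runs *)

Definition fall y := P y && ~~ P y.+1.

(** It covers [w.+1] positions, so its two ends differ by exactly [w]. *)
Definition run w x := all (fun j => P (x + j)) (iota 0 w.+1).

(** If [P] holds at [x + w], failure of the run from [x] forces a rise among the [w] positions
    ending at [x + w]. *)
Lemma cnt_no_run_rise w a b : 0 < w -> (forall x, a <= x < b -> ~~ run w x) ->
  cnt P (a + w) (b + w) <= w * cnt rise a.+1 (b + w).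
Proof.
move=> w0 no; rewrite -cnt_shift.
apply: leq_trans (_ : w * cnt (fun z => rise (z + 1)) a (b + w.-1) <= _); last first.
  by rewrite cnt_shift -addnA !addn1 prednK.
apply: leq_trans (cnt_windowU _ _ _ _); apply: cnt_sub => x /no nrun Pw.
apply: contraNT nrun => /hasPn nrise; apply/allP => j; rewrite mem_iota add0n /= ltnS => jw.
suff /(_ (w - j)) : forall i, i <= w -> P (x + (w - i)) by rewrite subKn // leq_subr; apply.
elim=> [|i IH] iw; first by rewrite subn0.
apply/negPn/negP => nP.
have : ~~ rise (x + (w - i.+1) + 1).
  by apply: nrise; rewrite mem_iota /= add0n ltn_subrL.
rewrite /rise -addnA -[w - i.+1 + 1](_ : w - i = _); last by rewrite addn1 subnSK.
by rewrite IH 1?ltnW // -addnBA ?subn_gt0 // subn1 -subnS nP.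
Qed.

(** Going forward instead, a fall is met among the [w] positions starting at [x]. *)
Lemma cnt_no_run_fall w a b : (forall x, a <= x < b -> ~~ run w x) ->
  cnt P a b <= w * cnt fall a (b + w.-1).
Proof.
move=> no; apply: leq_trans (cnt_windowU _ _ _ _); apply: cnt_sub => x /no nrun Px.
apply: contraNT nrun => /hasPn nfall; apply/allP => j; rewrite mem_iota add0n /= ltnS.
elim: j => [|j IH] jw; first by rewrite addn0.
apply/negPn/negP => nP.
have := nfall j; rewrite mem_iota /= add0n jw => /(_ isT).
by rewrite /fall IH 1?ltnW // -addnS nP.
Qed.
End Threshold.

(** * A missing length *)

Section MissingLength.
Variables (T : finType) (E : {set {set T}}) (f : {set T}) (m n d : nat).
Hypotheses (n2m : n = 2 * m) (m_gt1 : 1 < m).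
Hypotheses (cardT : #|T| = n) (unifE : uniform (m - 1) E).
Hypotheses (d_gt0 : 0 < d) (d_lt : d.+1 < n).
Hypothesis no_cycle : ~ has_cycle E d.+1.

Section Rotation.
Variables (v : nat -> T) (e : nat -> {set T}).
Hypothesis hp : ham_plus E n v e f.

Definition in_f i := v i \in f.
Definition in_e k i := v i \in e k.
Notation F := in_f.

Lemma v_period i : v (i + n) = v i.
Proof. by apply/eqP; rewrite (hp_v hp) modnDr. Qed.

Lemma F_period i : F (i + n) = F i.
Proof. by rewrite /F v_period. Qed.

Lemma F_n i : n <= i -> F i = F (i - n).
Proof. by move=> h; rewrite -(F_period (i - n)) subnK. Qed.

Lemma cnt_card (A : {set T}) : cnt (fun i => v i \in A) 0 n = #|A|.
Proof.
have v_inj : injective (fun i : 'I_n => v i).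
  move=> i j /eqP; rewrite (hp_v hp) !modn_small //; exact: val_eqP.
have v_bij : bijective (fun i : 'I_n => v i).
  by apply: inj_card_bij v_inj _; rewrite card_ord cardT.
rewrite -(on_card_preimset (f := fun i : 'I_n => v i)); last exact: onW_bij.
rewrite /cnt big_mkord -sum1_card [RHS]big_mkcond /=.
by apply: eq_bigr => i _; rewrite inE; case: (_ \in A).
Qed.

Lemma cnt_F a : cnt F a (a + n) = m - 1.
Proof. by rewrite (cnt_period _ F_period) cnt_card (unifE (hp_fE hp)). Qed.

Lemma cnt_e k a : cnt (in_e k) a (a + n) = m - 1.
Proof.
rewrite cnt_period; last by move=> i; rewrite /in_e v_period.
by rewrite cnt_card (unifE (hp_eE hp k)).
Qed.

Lemma e_neq j k : j != k -> j < k + n -> k < j + n -> e j != e k.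
Proof.
move=> h hj hk; rewrite (hp_e hp).
by rewrite (@eqn_mod_window n (minn j k)) //; lia.
Qed.

(** * Forbidden chord configurations *)

Lemma F_d i : F i -> ~~ F (i + d).
Proof.
move=> Fi; apply/negP => Fid; apply: no_cycle.
apply: (one_arc hp (g := f) (a := i)) => //; first by rewrite d_gt0 ltnW.
- exact: (hp_fE hp).
- by move=> j _; rewrite (hp_f hp).
Qed.

(** [n - d] is the shift by [d] backwards around the cycle. *)
Lemma F_db i : F i -> ~~ F (i + (n - d)).
Proof.
move=> Fi; apply/negP => /F_d/negP; apply.
by rewrite -addnA subnK ?F_period // ltnW // ltnW.
Qed.

Lemma e0_1 : in_e 0 1.
Proof. exact: (hp_inS hp). Qed.

Lemma e0_n : in_e 0 n.
Proof. by rewrite /in_e -[n]add0n v_period (hp_in hp). Qed.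

Let free i : 0 < i < n -> (e i != f) && (e i != e 0).
Proof. by move=> h; rewrite (hp_f hp) e_neq //; lia. Qed.

Let fE := hp_fE hp.
Let eE := hp_eE hp.

(** The cycle goes from [z] up to [p], through [f] to [q], up to [y] and through [e 0] back; the
    equation says that it has [d.+1] vertices. Arcs inside [1, n] never use [e 0]. *)
Lemma par_chords z p q y : 0 < z -> z <= p -> p < q -> q <= y -> y <= n ->
  in_e 0 z -> in_e 0 y -> F p -> F q -> p + y + 1 = d + z + q -> False.
Proof.
move=> z0 zp pq qy yn Hz Hy Fp Fq hl; apply: no_cycle.
have -> : d.+1 = ((p - z) + (y - q)).+2 by lia.
apply: (two_arcs_par hp (g := f) (g' := e 0) (a := z) (c := q));
  rewrite ?subnKC //; try lia.
- by rewrite eq_sym (hp_f hp).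
- by move=> i hi; apply: free; lia.
Qed.

(** The cycle goes from [p] up to [y], through [e 0] to [z], down to [q] and through [f] back. *)
Lemma anti_chords_in p y q z : 0 < p -> p <= y -> y < q -> q <= z -> z <= n ->
  in_e 0 z -> in_e 0 y -> F p -> F q -> y + z + 1 = d + p + q -> False.
Proof.
move=> z0 zp pq qy yn Hz Hy Fp Fq hl; apply: no_cycle.
have -> : d.+1 = ((y - p) + (z - q)).+2 by lia.
apply: (two_arcs_anti hp (g := e 0) (g' := f) (a := p) (c := q));
  rewrite ?subnKC //; try lia.
- exact: (hp_f hp).
- by move=> i hi; rewrite andbC; apply: free; lia.
Qed.

(** The cycle goes from [z] up to [p], through [f] to [q], down to [y] and through [e 0] back. *)
Lemma anti_chords_out z p y q : 0 < z -> z <= p -> p < y -> y <= q -> q <= n ->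
  in_e 0 z -> in_e 0 y -> F p -> F q -> p + q + 1 = d + z + y -> False.
Proof.
move=> z0 zp pq qy yn Hz Hy Fp Fq hl; apply: no_cycle.
have -> : d.+1 = ((p - z) + (q - y)).+2 by lia.
apply: (two_arcs_anti hp (g := f) (g' := e 0) (a := z) (c := y));
  rewrite ?subnKC //; try lia.
- by rewrite eq_sym (hp_f hp).
- by move=> i hi; apply: free; lia.
Qed.

Let free2 i : 1 < i < n -> (e i != e 0) && (e i != e 1).
Proof. by move=> h; rewrite !e_neq //; lia. Qed.

(** The cycle goes from 2 up to [y], through [e 0] to [n], down to [z] and through [e 1] back; it
    skips position 1. *)
Lemma consecutive_edges_anti y z : 1 < y -> y < z -> z <= n ->
  in_e 0 y -> in_e 1 z -> z - y = n - d - 1 -> False.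
Proof.
move=> y1 yz zn Hy Hz hl; apply: no_cycle.
have -> : d.+1 = ((y - 2) + (n - z)).+2 by lia.
have h01 : e 0 != e 1 by apply: e_neq; lia.
apply: (two_arcs_anti hp (g := e 0) (g' := e 1) (a := 2) (c := z));
  rewrite ?subnKC //; try lia.
- by move=> i hi; apply: free2; lia.
- exact: e0_n.
- exact: (hp_inS hp).
Qed.

(** The second arc is the single vertex [a], entered by [e 1] and left by [e 0]. *)
Lemma consecutive_edges_point y z a : 1 < y -> y <= z -> z < a -> a <= n ->
  in_e 0 y -> in_e 1 z -> in_e 0 a -> in_e 1 a -> z - y + 1 = d -> False.
Proof.
move=> y1 yz za an Hy Hz Ha Ha' hl; apply: no_cycle.
have -> : d.+1 = ((z - y) + 0).+2 by lia.
have h01 : e 1 != e 0 by apply: e_neq; lia.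
apply: (two_arcs_anti hp (g := e 1) (g' := e 0) (a := y) (c := a));
  rewrite ?subnKC ?addn0 //; try lia.
by move=> i hi; rewrite andbC; apply: free2; lia.
Qed.

(* [F] and [F + d] are disjoint and together miss two residues only. *)
Definition gap i := ~~ F i && ~~ F (i + (n - d)).
Definition gap' i := ~~ F i && ~~ F (i + d).

(** [F] and its translate are disjoint, and each has [m - 1] of the [2 * m] positions of a
    period. *)
Lemma cnt_gap_gen s a b : b <= a + n -> (forall i, F i -> ~~ F (i + s)) ->
  cnt (fun i => ~~ F i && ~~ F (i + s)) a b <= 2.
Proof.
move=> hb Fs; apply: leq_trans (cnt_wide _ (leqnn a) hb) _.
set G := fun i => _.
have h1 := cntC F a (a + n).
have h2 : cnt (fun i => F (i + s)) a (a + n) = m - 1.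
  by rewrite cnt_shift addnAC cnt_F.
have h3 : cnt (fun i => ~~ F i) a (a + n) = cnt G a (a + n) + cnt (fun i => F (i + s)) a (a + n).
  rewrite /cnt -big_split; apply: eq_bigr => i _; rewrite /G /=.
  by have := Fs i; case: (F i) (F (i + s)) => [] [] //= /(_ isT).
by rewrite cnt_F h3 h2 in h1; lia.
Qed.

Lemma cnt_gap a b : b <= a + n -> cnt gap a b <= 2.
Proof. by move=> h; apply: cnt_gap_gen h F_db. Qed.

Lemma cnt_gap' a b : b <= a + n -> cnt gap' a b <= 2.
Proof. by move=> h; apply: cnt_gap_gen h F_d. Qed.

(* Up to boundedly many positions in [1, n], [e 0] is [model] if [v 1] is in [f], and
   [model'] if [v n] is in [f]. *)
Definition model y := if y <= d then F y else F y.+1.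
Definition model' y := if y <= n - d then F y.-1 else F y.

(** A position of [e 0] outside [model] gives a gap, else a chord of [f] from position 1 closes a
    forbidden cycle: at most 2 on each side of [d]. As [e 0] has [m - 1] positions and [model] at
    most [m], the reverse difference is at most 5. *)
Lemma model_tight : F 1 -> cnt (fun y => model y && ~~ in_e 0 y) 1 n.+1 <= 5.
Proof.
move=> F1.
have dn : d.+1 <= n.+1 by lia.
have dn2 : d.+2 <= n.+1 by lia.
have h := cnt_diff (in_e 0) model 1 n.+1.
have h0 : cnt (in_e 0) 1 n.+1 = m - 1 by rewrite -[n.+1]add1n cnt_e.
(* Position [d.+1], left out by [model], is not in [F]; position [n.+1], taken in, repeats position
   1. *)
have h1 : cnt model 1 n.+1 <= m.
  rewrite (cnt_cat _ (isT : 0 < d.+1) dn).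
  have -> : cnt model 1 d.+1 = cnt F 1 d.+1.
    by apply: eq_cnt => i /andP[_]; rewrite ltnS /model => ->.
  have -> : cnt model d.+1 n.+1 = cnt F d.+2 n.+2.
    rewrite -[d.+2]addn1 -[n.+2]addn1 -cnt_shift; apply: eq_cnt => i /andP[h' _].
    by rewrite /model leqNgt h' addn1.
  have := cnt_F 1; rewrite add1n (cnt_cat _ (isT : 0 < d.+1) dn).
  rewrite (cnt_cat _ (leqnSn d.+1) dn2) cnt1.
  rewrite (cnt_cat F dn2 (leqnSn _)) cnt1.
  have := F_d F1; rewrite add1n => /negbTE->; case: (F n.+1); lia.
have h2 : cnt (fun y => in_e 0 y && ~~ model y) 1 n.+1 <= 4.
  rewrite (cnt_cat _ (isT : 0 < d.+1) dn) -[4]/(2 + 2).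
  apply: leq_add.
    apply: leq_trans (cnt_gap (a := 1) (b := d.+1) _); last by lia.
    apply: cnt_sub => i /andP[i0]; rewrite ltnS /model => id; rewrite id => /andP[Hi Fi].
    rewrite /gap Fi; apply/negP => Fq.
    have := anti_chords_in (p := 1) (y := i) (q := i + (n - d)) (z := n).
    by apply => //; rewrite ?e0_n //; lia.
  apply: leq_trans (cnt_gap (a := d.+2) (b := n.+2) _); last by lia.
  rewrite -[d.+2]addn1 -[n.+2]addn1 -cnt_shift; apply: cnt_sub => i /andP[id ilt].
  rewrite /model leqNgt id /= => /andP[Hi Fi].
  rewrite /gap addn1 Fi; apply/negP => Fq.
  have Fq' : F (i + 1 - d) by rewrite -F_period; congr F: Fq; lia.
  have := par_chords (z := 1) (p := 1) (q := i + 1 - d) (y := i).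
  by apply => //; rewrite ?e0_1 //; lia.
lia.
Qed.

(** Mirror image of [model_tight], with the vertex of [f] at the other end of [e 0]. *)
Lemma model'_tight : F n -> cnt (fun y => model' y && ~~ in_e 0 y) 1 n.+1 <= 5.
Proof.
move=> Fn; have F0 : F 0 by rewrite -F_period add0n.
set k := n - d; have kn : k.+1 <= n.+1 by rewrite /k; lia.
have h := cnt_diff (in_e 0) model' 1 n.+1.
have h0 : cnt (in_e 0) 1 n.+1 = m - 1 by rewrite -[n.+1]add1n cnt_e.
have h1 : cnt model' 1 n.+1 <= m.
  rewrite (cnt_cat _ (isT : 0 < k.+1) kn).
  have -> : cnt model' 1 k.+1 = cnt F 0 k.
    rewrite -[1]add0n -[k.+1]addn1 -cnt_shift.
    by apply: eq_cnt => i /andP[_ ik]; rewrite /model' addn1 /= -/k ik.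
  have -> : cnt model' k.+1 n.+1 = cnt F k.+1 n.+1.
    by apply: eq_cnt => i /andP[ik _]; rewrite /model' -/k leqNgt ik.
  have kn' : k <= n by rewrite leq_subr.
  have h2 := cnt_F 0; rewrite add0n in h2.
  have h3 : cnt F 0 n.+1 = m by rewrite (cnt_cat _ (leq0n n) (leqnSn n)) h2 cnt1 Fn; lia.
  have := h3; rewrite (cnt_cat _ (leq0n k) (leqW kn')) (cnt_cat _ (leqnSn k) kn) cnt1.
  by have := F_db F0; rewrite add0n -/k => /negbTE->; lia.
have h2 : cnt (fun y => in_e 0 y && ~~ model' y) 1 n.+1 <= 4.
  rewrite (cnt_cat _ (isT : 0 < k.+1) kn) -[4]/(2 + 2).
  apply: leq_add.
    apply: leq_trans (cnt_gap' (a := 0) (b := k) _); last by rewrite /k; lia.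
    rewrite -[1]add0n -[k.+1]addn1 -cnt_shift; apply: cnt_sub => i /andP[_ ik].
    rewrite /model' addn1 /= -/k ik => /andP[Hi Fi].
    rewrite /gap' Fi; apply/negP => Fq.
    have := par_chords (z := i.+1) (p := i + d) (q := n) (y := n).
    by apply => //; rewrite ?e0_n //; rewrite /k in ik; lia.
  apply: leq_trans (cnt_gap' (a := k.+1) (b := n.+1) _); last by lia.
  apply: cnt_sub => i /andP[ki ilt].
  rewrite /model' -/k leqNgt ki /= => /andP[Hi Fi].
  rewrite /gap' Fi; apply/negP => Fq.
  have Fq' : F (i + d - n) by rewrite -F_n //; rewrite /k in ki; lia.
  have := anti_chords_out (z := 1) (p := i + d - n) (y := i) (q := n).
  by apply => //; rewrite ?e0_1 //; rewrite /k in ki; lia.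
lia.
Qed.

(** By [model_tight], [y] in [F] lies in [e 0] with at most 5 exceptions; the chords through
    position [s.+1] then put [y - s] in [F], except for at most 2 gaps. *)
Lemma F_decreasing s : F 1 -> F s.+1 -> 0 < s -> s < d -> s < n - d ->
  cnt (fun y => F y && ~~ F (y - s)) s.+1 d.+1 <= 7.
Proof.
move=> F1 Fs s0 sd sdb; rewrite -[7]/(5 + 2).
apply: leq_trans (leq_add (model_tight F1) (cnt_gap (a := 1) (b := d.+1 - s) _)); last by lia.
have -> : cnt gap 1 (d.+1 - s) = cnt (fun y => gap (y - s)) s.+1 d.+1.
  have := cnt_shift (fun y => gap (y - s)) s 1 (d.+1 - s).
  rewrite add1n subnK => [<-|]; last by lia.
  by apply: eq_cnt => i _; rewrite addnK.
apply: leq_trans (leq_add (cnt_wide _ (_ : 1 <= s.+1) (_ : d.+1 <= n.+1)) (leqnn _)); [|lia..].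
apply: cnt_subU => y /andP[sy yd] /andP[Fy Fys]; rewrite ltnS in yd.
rewrite /model yd Fy /=; case: (boolP (in_e 0 y)) => //= Hy.
rewrite /gap Fys; apply/negP => Fq.
have := anti_chords_in (p := s.+1) (y := y) (q := y - s + (n - d)) (z := n).
by apply => //; rewrite ?e0_n //; lia.
Qed.

(** The same argument beyond [d], with parallel chords. *)
Lemma F_increasing s : F 1 -> F s.+1 -> 0 < s -> s < d -> s < n - d ->
  cnt (fun y => F y.+1 && ~~ F (y.+1 + s)) d.+1 n.+1 <= 7.
Proof.
move=> F1 Fs s0 sd sdb; rewrite -[7]/(5 + 2).
apply: leq_trans (leq_add (model_tight F1)
  (cnt_gap (a := d.+1 + s.+1) (b := n.+1 + s.+1) _)); last by lia.
rewrite -cnt_shift.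
apply: leq_trans (leq_add (cnt_wide _ (_ : 1 <= d.+1) (leqnn n.+1)) (leqnn _)); [|lia..].
apply: cnt_subU => y /andP[dy yn] /andP[Fy Fys].
rewrite /model leqNgt dy Fy /=; case: (boolP (in_e 0 y)) => //= Hy.
rewrite -addSnnS /gap Fys; apply/negP => Fq.
have Fq' : F (y.+1 + s - d) by rewrite -F_period; congr F: Fq; lia.
have := par_chords (z := 1) (p := s.+1) (q := y.+1 + s - d) (y := y).
by apply => //; rewrite ?e0_1 //; lia.
Qed.

End Rotation.

(** * No two consecutive vertices in [f] *)

Section NoConsecutive.
Variables (v : nat -> T) (e : nat -> {set T}).
Hypothesis hp : ham_plus E n v e f.
Notation F := (in_f v).
Hypothesis F_1 : forall i, F i -> ~~ F (i + 1).

Definition gap1 i := ~~ F i && ~~ F (i + 1).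

Lemma cnt_gap1 a b : b <= a + n -> cnt gap1 a b <= 2.
Proof. by move=> h; apply: (cnt_gap_gen hp) h F_1. Qed.

(** Apart from at most two gaps, a position outside [F] is followed by one in [F]. *)
Lemma F_half a b : b <= a + n -> b - a <= 2 * cnt F a b + 3.
Proof.
move=> h; have [ba|ab] := leqP b a; first by lia.
have h1 := cntC F a b.
have h2 : cnt (fun i => ~~ F i) a b <= cnt F (a + 1) (b + 1) + 2.
  apply: leq_trans (leq_add (leqnn _) (cnt_gap1 h)).
  by rewrite -cnt_shift; apply: cnt_subU => i _ Fi; rewrite /gap1 Fi; case: (F _).
have h3 : cnt F (a + 1) (b + 1) <= cnt F a b + 1.
  rewrite !addn1; apply: leq_trans (cnt_wide F (leqnSn a) (leqnn _)) _.
  by rewrite (cnt_cat F (ltnW ab) (leqnSn b)) cnt1; case: (F b); lia.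
lia.
Qed.

Hypothesis F1 : F 1.
(** In the numbering shifted by one, [e 1] has index 0 and the vertex [v 1] of [f] has position [n],
    so [model'_tight] controls [e 1]. *)
Let v1 i := v (1 + i).
Let bad y := model v y && ~~ in_e v e 0 y.
Let bad1 y := model' v1 y && ~~ in_e v e 1 y.+1.

Let F_v1 i : in_f v1 i = F i.+1.
Proof. by []. Qed.

Let bad_le a b : 0 < a -> b <= n.+1 -> cnt bad a b <= 5.
Proof. by move=> ha hb; apply: leq_trans (model_tight hp F1); apply: cnt_wide. Qed.

Let bad1_le a b : 0 < a -> b <= n.+1 -> cnt bad1 a b <= 5.
Proof.
move=> ha hb; have F1n : in_f v1 n by rewrite /in_f /v1 (v_period hp).
apply: leq_trans (model'_tight (ham_plus_shift 1 hp) F1n).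
exact: cnt_wide.
Qed.

(** For [y] in [F], [y + (n - d)] is not in [F], so [y + (n - d - 1)] almost always is. With [y] in
    [e 0] and the latter in [e 1], a forbidden cycle closes. Hence [3, d] has only exceptional
    positions of [F], at most 12. *)
Lemma no_consecutive_d_small : d <= 29.
Proof.
have [d2|d2] := leqP d 2; first by lia.
suff : cnt F 3 d.+1 <= 12 by have := @F_half 3 d.+1; lia.
have h1 : cnt bad 3 d.+1 <= 5 by apply: bad_le; lia.
have h2 : cnt bad1 (3 + (n - d - 2)) (d.+1 + (n - d - 2)) <= 5 by apply: bad1_le; lia.
have h3 : cnt gap1 (3 + (n - d - 1)) (d.+1 + (n - d - 1)) <= 2 by apply: cnt_gap1; lia.
rewrite -[12]/(5 + (5 + 2)).
apply: leq_trans (leq_add h1 (leq_add h2 h3)); rewrite -!cnt_shift.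
apply: leq_trans (leq_add (leqnn _) (cntU _ _ _ _)).
apply: cnt_subU => y /andP[y3 yd] Fy; apply/negPn/negP; rewrite !negb_or => /and3P[b1 b2 b3].
have Hy : in_e v e 0 y.
  by move: b1; rewrite /bad /model; have -> : y <= d by []; rewrite Fy /= negbK.
have Fz : F (y + (n - d - 1)).
  move: b3; rewrite /gap1 negb_and !negbK => /orP[//|].
  by have := F_db hp Fy; have -> : y + (n - d - 1) + 1 = y + (n - d) by [lia]; move=> /negbTE->.
have Hz : in_e v e 1 (y + (n - d - 1)).
  move: b2; rewrite /bad1 /model'.
  have -> : (y + (n - d - 2) <= n - d) = false by lia.
  rewrite F_v1.
  by have -> : (y + (n - d - 2)).+1 = y + (n - d - 1) by [lia]; rewrite Fz /= negbK.
by apply: (consecutive_edges_anti hp (y := y) (z := y + (n - d - 1))) => //; lia.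
Qed.

Lemma edges_common a0 : d < a0 -> a0 + 40 + d <= n ->
  exists2 a, a0 <= a < a0 + 40 & in_e v e 0 a && in_e v e 1 a.
Proof.
move=> da an; have ha : 0 < a0 by lia.
have an1 : a0 + 40 <= n by lia.
have [a /andP[ha1 ha2] /andP[Fa]] : exists2 a, a0 <= a < a0 + 40 & F (a + 1) &&
    ~~ (bad a || (bad1 (a - 1) || gap1 (a - 1))).
  apply: cnt_exists_diff; rewrite cnt_shift.
  (* At most 12 failures, against at least 19 positions of [F] among 40. *)
  apply: (@leq_ltn_trans (5 + (5 + 2))).
    have sh P : cnt (fun a => P (a - 1)) a0 (a0 + 40) = cnt P (a0 - 1) (a0 + 40 - 1).
      have := cnt_shift (fun a => P (a - 1)) 1 (a0 - 1) (a0 + 40 - 1).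
      rewrite !subnK; [|lia..] => <-; by apply: eq_cnt => i _; rewrite addnK.
    apply: leq_trans (cntU _ _ _ _) (leq_add (bad_le _ _) _) => //; first exact: leqW.
    apply: leq_trans (cntU _ _ _ _) (leq_add _ _); rewrite sh; last by apply: cnt_gap1; lia.
    have [a1|a1] := leqP a0 1; last by apply: bad1_le; lia.
    by move: da d_gt0 a1; clear; lia.
  by have := @F_half (a0 + 1) (a0 + 40 + 1); move: an1 n2m; clear; lia.
rewrite !negb_or => /and3P[a1 a2 a3]; exists a; first by rewrite ha1.
have a_gt0 : 0 < a := leq_trans ha ha1.
have ad : (a <= d) = false by rewrite leqNgt (leq_trans da ha1).
have and' : a - 1 <= n - d by move: ha2 an; clear; lia.
have Fa1 : F (a - 1).
  move: a3; rewrite /gap1 negb_and !negbK => /orP[//|].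
  by rewrite subnK // => /F_1; rewrite Fa.
have ap : (a - 1).-1.+1 = a - 1 by move: ad d_gt0; clear; lia.
move: a1 a2; rewrite /bad /bad1 /model /model' ad and' F_v1 ap -addn1 Fa Fa1 !andTb !negbK.
by rewrite subn1 prednK // => -> ->.
Qed.

(** [y + 1] in [F] excludes [y + 1 + d], which up to gaps puts [y + d] and then [y + d - 2] in [F];
    the models then give membership in [e 0] and [e 1]. *)
Lemma edges_shifted y0 : d < y0 -> y0 + 40 + d + d <= n ->
  exists2 y, y0 <= y < y0 + 40 & in_e v e 0 y && in_e v e 1 (y + d - 1).
Proof.
move=> dy yn; have hy : 0 < y0 by lia.
have yn1 : y0 + 40 + d <= n by lia.
have [y /andP[hy1 hy2] /andP[Fy]] : exists2 y, y0 <= y < y0 + 40 & F (y + 1) &&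
    ~~ (bad y || (bad1 (y + d - 2) || (gap1 (y + d) || gap1 (y + d - 2)))).
  apply: cnt_exists_diff; rewrite cnt_shift.
  have sh P : cnt (fun y => P (y + d - 2)) y0 (y0 + 40) = cnt P (y0 + d - 2) (y0 + 40 + d - 2).
    rewrite (cnt_shift (fun y => P (y - 2))).
    have := cnt_shift (fun y => P (y - 2)) 2 (y0 + d - 2) (y0 + 40 + d - 2).
    rewrite !subnK; [|lia..] => <-; by apply: eq_cnt => i _; rewrite addnK.
  apply: (@leq_ltn_trans (5 + (5 + (2 + 2)))).
    apply: leq_trans (cntU _ _ _ _) (leq_add (bad_le _ _) _) => //; first by lia.
    apply: leq_trans (cntU _ _ _ _) (leq_add _ _).
      rewrite sh; apply: bad1_le; last by lia.
      by move: d_gt0 dy; clear; lia.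
    apply: leq_trans (cntU _ _ _ _) (leq_add _ _); rewrite ?sh ?cnt_shift;
    by apply: cnt_gap1; lia.
  by have := @F_half (y0 + 1) (y0 + 40 + 1); move: yn1 n2m; clear; lia.
rewrite !negb_or => /and4P[b1 b2 b3 b4]; exists y; first by rewrite hy1.
have yd : (y <= d) = false by rewrite leqNgt (leq_trans dy hy1).
have zd : y + d - 2 <= n - d by move: hy2 yn; clear; lia.
have z1 : (y + d - 2).-1.+1 = y + d - 2 by move: yd d_gt0; clear; lia.
have z2 : (y + d - 2).+1 = y + d - 1 by move: yd d_gt0; clear; lia.
have z3 : y + d - 2 + 1 + 1 = y + d by move: yd d_gt0; clear; lia.
have Fyd : F (y + d).
  move: b3; rewrite /gap1 negb_and !negbK => /orP[//|].
  by have := F_d hp Fy; rewrite addnAC => /negbTE->.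
have Fz : F (y + d - 2).
  move: b4; rewrite /gap1 negb_and !negbK => /orP[//|] /F_1.
  by rewrite z3 Fyd.
move: b1 b2; rewrite /bad /bad1 /model /model' yd zd F_v1 z1 z2 -(addn1 y) Fy Fz.
by rewrite !andTb !negbK => -> ->.
Qed.

Lemma no_consecutive_false : 100 <= m -> False.
Proof.
move=> m100; have d29 := no_consecutive_d_small.
(* The window for [a] starts beyond all possible values of [y + d - 1]; both windows fit because
   [d <= 29]. *)
have [||y /andP[y1 y2] /andP[Hy Hz]] := @edges_shifted d.+1; [by []|by lia|].
have [||a /andP[a1 a2] /andP[Ha Ha1]] := @edges_common (d.+1 + 40 + d); [by lia..|].
by apply: (consecutive_edges_point hp (y := y) (z := y + d - 1) (a := a)) => //;
  move: y1 y2 a1 a2 d29 m100 n2m d_gt0; clear; lia.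
Qed.
End NoConsecutive.

(** * Consecutive vertices in [f] *)

(* The hyperedge [e 0] is opposite to the interval [a, a + m - K) on which [F] is dense. *)
Section DenseInterval.
Variables (v : nat -> T) (e : nat -> {set T}).
Hypothesis hp : ham_plus E n v e f.
Notation F := (in_f v).
Variables (K a : nat).
Hypotheses (K_gt0 : 0 < K) (Km : 40 * K <= m) (a_half : a = m %/ 2).
Hypothesis dense : cnt (fun y => ~~ F y) a (a + (m - K)) <= K.

Lemma dense_sub c1 c2 : a <= c1 -> c2 <= a + (m - K) -> cnt (fun y => ~~ F y) c1 c2 <= K.
Proof. by move=> h1 h2; apply: leq_trans dense; apply: cnt_wide. Qed.

(** Each [y] yields a position outside [F], either [y] or [y + s], and each kind occurs at most [K]
    times. *)
Lemma dense_shift s c1 c2 : a <= c1 -> c2 + s <= a + (m - K) ->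
  (forall y, c1 <= y < c2 -> ~~ F y || ~~ F (y + s)) -> c2 - c1 <= K + K.
Proof.
move=> h1 h2 h.
have h3 := @dense_sub c1 c2 h1 (leq_trans (leq_addr s c2) h2).
have h4 := @dense_sub (c1 + s) (c2 + s) (leq_trans h1 (leq_addr s c1)) h2.
rewrite -cnt_shift in h4; apply: leq_trans (leq_add h3 h4).
exact: cnt_cover.
Qed.

Lemma dense_reflect N c1 c2 : a <= c1 -> c2 <= a + (m - K) -> a + c2 <= N.+1 ->
  N.+1 <= c1 + (a + (m - K)) ->
  (forall y, c1 <= y < c2 -> ~~ F y || ~~ F (N - y)) -> c2 - c1 <= K + K.
Proof.
move=> h1 h2 h3 h4 h.
have h5 := @dense_sub c1 c2 h1 h2.
have h6 : cnt (fun y => ~~ F (N - y)) c1 c2 <= K.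
  rewrite (cnt_reflect (fun y => ~~ F y)); last by move: h3; clear; lia.
  by apply: dense_sub; [move: h3|move: h4]; clear; lia.
apply: leq_trans (leq_add h5 h6).
exact: cnt_cover.
Qed.

(** Otherwise the dense interval overlaps its translate by [d] in more than [2 * K] positions,
    against [F_d]. *)
Lemma dense_d : m <= d + 3 * K.
Proof.
suff : m - K - d <= K + K by clear; lia.
have [md|dm] := leqP (m - K) d; first by move: md; clear; lia.
rewrite -[m - K - d](addKn a) addnBA; last exact: ltnW.
apply: (dense_shift (s := d)) => //; first by move: dm; clear; lia.
by move=> y _; rewrite -negb_and; apply/negP => /andP[/(F_d hp)/negbTE->].
Qed.

Lemma dense_db : m <= (n - d) + 3 * K.
Proof.
suff : m - K - (n - d) <= K + K by clear; lia.
have [md|dm] := leqP (m - K) (n - d); first by move: md; clear; lia.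
rewrite -[m - K - (n - d)](addKn a) addnBA; last exact: ltnW.
apply: (dense_shift (s := n - d)) => //; first by move: dm; clear; lia.
by move=> y _; rewrite -negb_and; apply/negP => /andP[/(F_db hp)/negbTE->].
Qed.

(** If [e 0] contained [y] besides [n], [anti_chords_in] would forbid pairs of [F] around [y] with
    sum [y.+1 + (n - d)], but the dense interval has too many reflected pairs. *)
Lemma dense_core_notin y : a + 3 * K <= y < a + (m - K) - 3 * K -> ~~ in_e v e 0 y.
Proof.
move=> /andP[y1 y2]; apply/negP => Hy.
have hd := dense_d; have hdb := dense_db.
(* [q0] puts [q] beyond [y] and its partner at or below [y]; [q1] keeps both in the dense
   interval. *)
set q0 := maxn y.+1 (n - d).+1.
set q1 := minn (a + (m - K)) (y.+2 + (n - d) - a).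
have q01 : K + K < q1 - q0.
  by move: y1 y2 hd hdb K_gt0 Km a_half n2m; rewrite /q0 /q1; clear; lia.
move: q01; rewrite ltnNge => /negP; apply.
apply: (dense_reflect (N := y.+1 + (n - d))).
- by move: y1; rewrite /q0; clear; lia.
- by rewrite /q1 geq_minl.
- by move: y1; rewrite /q1; clear; lia.
- by move: y2 K_gt0; rewrite /q0; clear; lia.
move=> q /andP[hq0 hq1]; rewrite -negb_and; apply/negP => /andP[Fq Fp].
have hb : [/\ y < q, n - d < q, q <= n & q <= y.+1 + (n - d) - a].
  split; move: hq0 hq1 Km a_half n2m; rewrite /q0 /q1; clear; lia.
case: hb => b1 b2 b3 b4.
apply: (anti_chords_in hp (p := y.+1 + (n - d) - q) (y := y) (q := q) (z := n)) => //;
  rewrite ?(e0_n hp) //; move: b1 b2 b3 b4 y1 Km K_gt0 a_half d_lt; clear; lia.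
Qed.

(** Here [par_chords] with [z] and [n] would forbid pairs of [F] at distance [(n - d).+1 - z]. *)
Lemma dense_flank_notin z : 8 * K <= z < a -> ~~ in_e v e 0 z.
Proof.
move=> /andP[z1 z2]; apply/negP => Hz.
have hd := dense_d; have hdb := dense_db.
set s := (n - d).+1 - z.
have s0 : 0 < s by rewrite /s; move: hdb z2 a_half Km K_gt0; clear; lia.
suff : a + (m - K) - s - a <= K + K.
  by move: hd z1 K_gt0 Km a_half n2m; rewrite /s; clear; lia.
apply: (dense_shift (s := s)) => //.
  by move: hd z1 K_gt0 Km a_half n2m; rewrite /s; clear; lia.
move=> p /andP[p1 p2]; rewrite -negb_and; apply/negP => /andP[Fp Fq].
apply: (par_chords hp (z := z) (p := p) (q := p + s) (y := n)) => //;
  rewrite ?(e0_n hp) //; move: s0 p1 p2 z1 z2 hd hdb Km K_gt0 a_half d_lt n2m; rewrite /s;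
  clear; lia.
Qed.

(** [e 0] misses [m + 1] positions, but flank and core together have [m + a - 15 * K], which is more
    since [40 * K <= m]. *)
Lemma dense_interval_false : False.
Proof.
pose nH y := ~~ in_e v e 0 y.
have h := cntC (in_e v e 0) 1 n.+1; rewrite -{1}[n.+1]add1n (cnt_e hp) -/nH in h.
set c2 := a + 3 * K; set c3 := a + (m - K) - 3 * K.
have c12 : 8 * K <= a by move: Km a_half; clear; lia.
have h1 : cnt nH (8 * K) a = a - 8 * K by apply: cnt_full => y; apply: dense_flank_notin.
have h2 : cnt nH c2 c3 = c3 - c2 by apply: cnt_full => y; apply: dense_core_notin.
have h3 : cnt nH (8 * K) a + cnt nH c2 c3 <= cnt nH 1 n.+1.
  have ac2 : a <= c2 by rewrite leq_addr.
  have c23 : c2 <= c3 by move: Km K_gt0; rewrite /c2 /c3; clear; lia.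
  have b1 := cnt_cat nH c12 (leq_trans ac2 c23).
  have b2 := cnt_cat nH ac2 c23.
  have b3 : cnt nH (8 * K) c3 <= cnt nH 1 n.+1.
    by apply: cnt_wide; [move: K_gt0|move: n2m a_half; rewrite /c3]; clear; lia.
  by move: b1 b2 b3; clear; lia.
by move: h h1 h2 h3 n2m a_half Km K_gt0; rewrite /c2 /c3; clear; lia.
Qed.
End DenseInterval.

(** * From two consecutive vertices of [f] to a dense interval *)

Lemma long_run v e : ham_plus E n v e f -> 200 <= m -> in_f v 1 -> in_f v 2 ->
  exists2 x, 0 < x & run (in_f v) 8 x.
Proof.
move=> hp m200 F1 F2; set F := in_f v in F1 F2 *.
have d1 : 1 < d.
  rewrite ltn_neqAle d_gt0 andbT; apply/eqP => d1.
  by have := F_d hp F1; rewrite -/F -d1 F2.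
have db1 : 1 < n - d.
  rewrite ltn_neqAle; apply/andP; split; last by move: d_lt; clear; lia.
  by apply/eqP => d2; have := F_db hp F1; rewrite -/F -d2 F2.
have [/hasP[x]|/hasPn no] := boolP (has (run F 8) (iota 1 n)).
  by rewrite mem_iota => /andP[x0 _]; exists x.
have nrun x : 0 < x -> x <= n -> ~~ run F 8 x by move=> *; apply: no; rewrite mem_iota; lia.
have rises := F_decreasing hp F1 F2 isT d1 db1.
have falls := F_increasing hp F1 F2 isT d1 db1; rewrite -/F in rises falls.
(* The first nine positions are counted in full; beyond them each of at most 7 rises accounts for 8
   positions. *)
have h1 : cnt F 1 d.+1 <= 9 + 8 * 7.
  have [d10|d10] := leqP d.+1 10; first by apply: leq_trans (cnt_size _ _ _) _; lia.
  have d8 : 8 <= d.+1 by apply: leq_trans (ltnW d10).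
  rewrite (@cnt_cat F 1 10) ?(ltnW d10) //; apply: leq_add; first exact: cnt_size.
  rewrite -[10]/(2 + 8) -(subnK d8).
  apply: leq_trans (cnt_no_run_rise _ _) _ => // [x /andP[x2 xd]|].
    by apply: nrun; [exact: ltnW|move: xd d_lt; clear; lia].
  rewrite subnK // leq_mul2l /=; apply: leq_trans rises.
  exact: cnt_wide.
have h2 : cnt F d.+2 n.+1 <= 8 + 8 * 7.
  have [nd|nd] := leqP n.+1 (d.+2 + 8); first by apply: leq_trans (cnt_size _ _ _) _; lia.
  have n8 : 8 <= n.+1 by apply: leq_trans (ltnW nd); rewrite leq_addl.
  have dn8 : d.+2 <= n.+1 - 8 by rewrite leq_subRL // addnC ltnW.
  rewrite (@cnt_cat F d.+2 (n.+1 - 8)) ?leq_subr // addnC leq_add //.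
    by apply: leq_trans (cnt_size _ _ _) _; rewrite subKn.
  apply: leq_trans (cnt_no_run_fall (w := 8) _) _ => [x /andP[xd xn]|].
    by apply: nrun; move: xd xn; clear; lia.
  rewrite leq_mul2l /=; apply: leq_trans falls.
  apply: leq_trans (_ : _ <= cnt (fall F) (d.+1 + 1) (n + 1)) _.
    by apply: cnt_wide; move: n8; clear; lia.
  rewrite -cnt_shift; apply: leq_trans (cnt_wide _ (leqnn _) (leqnSn n)).
  by apply: cnt_sub => i _; rewrite /fall !addn1.
have := cnt_F hp 1; rewrite -/F add1n (@cnt_cat F 1 d.+1) //; last by apply: ltnW; apply: ltnW.
rewrite (@cnt_cat F d.+1 d.+2) // ?cnt1; last exact: ltnW.
by move: h1 h2 m200 (leq_b1 (F d.+1)); clear; lia.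
Qed.

Lemma run_false v e : ham_plus E n v e f -> 40 * 144 <= m ->
  (forall j, 0 < j <= 9 -> in_f v j) -> False.
Proof.
move=> hp m_large hrun; set F := in_f v in hrun *.
have [F1 F2 F9] : [/\ F 1, F 2 & F 9] by split; apply: hrun.
have d8 : 8 < d.
  rewrite ltnNge; apply/negP => d8; have := F_d hp F1; rewrite -/F add1n hrun //.
have db8 : 8 < n - d.
  by rewrite ltnNge; apply/negP => d8'; have := F_db hp F1; rewrite -/F add1n hrun.
have db1 : 1 < n - d by apply: leq_trans db8.
have d1 : 1 < d by apply: leq_trans d8.
pose P j := F j.+1; pose Q j := F (n.+1 - j).
have [t1 [t1d ones1 zeros1]] : exists t, [/\ t <= d, cnt (fun y => ~~ P y) 0 t <= 8 * 9
    & cnt P t d <= 8 * 8].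
  apply: threshold => //.
    rewrite ltnS; apply: leq_trans (F_decreasing hp F1 F9 isT d8 db8).
    rewrite -[9]/(8 + 1) -[d.+1]addn1 -cnt_shift; apply: cnt_sub => y /andP[y8 _].
    by rewrite /P addn1 subSn.
  apply: leq_trans (F_decreasing hp F1 F2 isT d1 db1).
  rewrite -[2]/(1 + 1) -[d.+1]addn1 -cnt_shift; apply: cnt_sub => y /andP[y8 _].
  by rewrite /rise /P addn1 subSn.
have [t2 [t2d ones2 zeros2]] : exists t, [/\ t <= n - d, cnt (fun y => ~~ Q y) 0 t <= 8 * 9
    & cnt Q t (n - d) <= 8 * 8].
  have refl s : 0 < s -> cnt (fun y => Q y && ~~ Q (y - s)) s (n - d) <=
      cnt (fun y => F y.+1 && ~~ F (y.+1 + s)) d.+1 n.+1.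
    move=> s0; apply: leq_trans (cnt_wide (a := n.+1 - (n - d)) (b := n.+1 - s) _ _ _).
    - rewrite -cnt_reflect; last by rewrite ltnW // ltnS leq_subr.
      apply: cnt_sub => y /andP[sy yd]; rewrite /Q -subSn; last first.
        by move: yd; clear; lia.
      by have -> : n.+1 - (y - s) = n.+1 - y + s by [move: sy yd; clear; lia].
    - by rewrite subSn ?leq_subr // subKn // ltnW // ltnW.
    - exact: leq_subr.
  apply: threshold => //.
    by rewrite ltnS; apply: leq_trans (refl 8 isT) _; exact: (F_increasing hp F1 F9).
  by apply: leq_trans (refl 1 isT) _; exact: (F_increasing hp F1 F2).
have ones1' : cnt (fun y => ~~ F y) 1 t1.+1 <= 72.
  by rewrite -[1]add0n -[t1.+1]addn1 -cnt_shift; under eq_cnt do rewrite addn1.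
have zeros1' : cnt F t1.+1 d.+1 <= 64.
  by rewrite -[t1.+1]addn1 -[d.+1]addn1 -cnt_shift; under eq_cnt do rewrite addn1.
have t2n : t2 <= n by apply: leq_trans t2d (leq_subr _ _).
have ones2' : cnt (fun y => ~~ F y) (n.+2 - t2) n.+2 <= 72.
  by rewrite -[X in cnt _ _ X]subn0 -cnt_reflect //; apply/leqW/leqW.
have zeros2' : cnt F d.+2 (n.+2 - t2) <= 64.
  have -> : d.+2 = n.+2 - (n - d) by move: d_lt; clear; lia.
  by rewrite -cnt_reflect //; apply/leqW/leqW/leq_subr.
have tm : m <= t1 + t2 + 130.
  have := cnt_F hp 1; rewrite -/F add1n.
  have := cnt_size F 1 t1.+1; have := cnt_size F (n.+2 - t2) n.+1.
  rewrite (@cnt_cat F 1 t1.+1 n.+1) //; last first.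
    by rewrite ltnS; apply: leq_trans t1d _; apply: ltnW; apply: ltnW.
  rewrite (@cnt_cat F t1.+1 d.+1 n.+1) //; last by rewrite ltnS; apply: ltnW; apply: ltnW.
  rewrite (@cnt_cat F d.+1 d.+2 n.+1) // ?cnt1; last exact: ltnW.
  have [t20|t2pos] := posnP t2.
    have := cnt_wide F (leqnn d.+2) (_ : n.+1 <= n.+2 - t2).
    rewrite t20 subn0 in zeros2' * => /(_ (leqnSn _)).
    by move: zeros1' zeros2' (leq_b1 (F d.+1)) m_large; clear; lia.
  rewrite (@cnt_cat F d.+2 (n.+2 - t2) n.+1) //; [|by move: t2d d_lt t2pos; clear; lia..].
  by move: zeros1' zeros2' (leq_b1 (F d.+1)) m_large t2pos t2n; clear; lia.
have dense : cnt (fun y => ~~ F y) (n.+2 - t2) (n.+2 - t2 + (m - 144)) <= 144.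
  have b1 : n.+2 - t2 <= n.+2 by exact: leq_subr.
  have b2 : n.+2 <= maxn n.+2 (n + t1.+1) by exact: leq_maxl.
  apply: leq_trans (cnt_wide (b' := maxn n.+2 (n + t1.+1)) _ (leqnn _) _) _.
    by move: tm t2n; clear; lia.
  rewrite (cnt_cat _ b1 b2) -[144]/(72 + 72); apply: leq_add => //.
  apply: leq_trans ones1'.
  have -> : cnt (fun y => ~~ F y) 1 t1.+1 = cnt (fun y => ~~ F y) n.+1 (t1.+1 + n).
    by rewrite -[n.+1]add1n -cnt_shift; apply: eq_cnt => i _; rewrite /F (F_period hp).
  have [h|h] := leqP (n + t1.+1) n.+2; first by rewrite cnt_nil.
  by rewrite addnC; apply: cnt_wide.
have hp' := ham_plus_shift (n.+2 - t2 + (n - m %/ 2)) hp.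
apply: (dense_interval_false hp' (K := 144) (a := m %/ 2)) => //.
apply: leq_trans dense; set b := n.+2 - t2; set k := m - 144; set a := m %/ 2.
have an : a <= n by rewrite /a n2m; clear; lia.
have -> : cnt (fun y => ~~ F y) b (b + k) = cnt (fun y => ~~ F (y + n)) b (b + k).
  by apply: eq_cnt => i _; rewrite /F (F_period hp).
rewrite (cnt_shift (fun y => ~~ F y)).
have -> : b + n = a + (b + (n - a)) by move: an; clear; lia.
have -> : b + k + n = a + k + (b + (n - a)) by move: an; clear; lia.
rewrite -cnt_shift; apply: cnt_sub => i _.
by rewrite /F /in_f addnC.
Qed.

Lemma consecutive_false v e i : ham_plus E n v e f -> 40 * 144 <= m ->
  in_f v i -> in_f v (i + 1) -> False.
Proof.
move=> hp m_large Fi Fi1.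
have hp' := ham_plus_shift (i + n - 1) hp.
have in1 : i + n - 1 + 1 = i + n by rewrite subnK // ltn_addl // ltnW // (ltn_trans _ d_lt).
have [|||x x0 /allP hx] := long_run hp'.
- by apply: leq_trans m_large.
- by rewrite /in_f in1 (v_period hp).
- by rewrite /in_f -[2]/(1 + 1) addnA in1 addnAC (v_period hp).
apply: (run_false (ham_plus_shift (x - 1) hp') m_large) => j /andP[j0 j9].
have := hx (j - 1); rewrite mem_iota /= add0n ltnS leq_subLR => /(_ j9).
by rewrite /in_f; congr (v _ \in f); move: x0 j0; clear; lia.
Qed.

Lemma missing_length_false v e : ham_plus E n v e f -> 40 * 144 <= m -> False.
Proof.
move=> hp m_large.
have F_1 v' e' : ham_plus E n v' e' f -> forall i, in_f v' i -> ~~ in_f v' (i + 1).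
  by move=> hp' i Fi; apply/negP; exact: consecutive_false hp' m_large Fi.
have [i _ Fi] : exists2 i, 0 <= i < 0 + n & in_f v i.
  by apply: cnt_exists; rewrite (cnt_F hp) subn_gt0.
have hp' := ham_plus_shift (i + n - 1) hp.
apply: (no_consecutive_false hp' (F_1 _ _ hp')); last by apply: leq_trans m_large.
by rewrite /in_f subnK ?(v_period hp) // ltn_addl // ltnW // (ltn_trans _ d_lt).
Qed.

End MissingLength.

Lemma ham_plus_of_cycle (T : finType) (E : {set {set T}}) l (x : 'I_l -> T)
    (h : 'I_l -> {set T}) f : berge_cycle E x h -> f \notin cycle_edges h ->
  exists v e, ham_plus (f |: cycle_edges h) l v e f.
Proof.
case=> l2 x_inj h_inj _ inc fC; have l0 : 0 < l by exact: ltnW.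
pose o i : 'I_l := Ordinal (ltn_pmod i l0).
have oE i j : (o i == o j) = (i == j %[mod l]) by rewrite -val_eqE.
have oS i : o i.+1 = ordS (o i) by apply: val_inj; rewrite /= -addn1 -modnDml addn1.
have hC i : h i \in cycle_edges h by exact: imset_f.
exists (fun i => x (o i)), (fun i => h (o i)); split => [i j|i j|i|i|i|i|].
- by rewrite (inj_eq x_inj).
- by rewrite (inj_eq h_inj).
- by apply: (subsetP (inc (o i))); rewrite !inE eqxx.
- by apply: (subsetP (inc (o i))); rewrite oS !inE eqxx orbT.
- by apply: contraNneq fC => <-.
- by rewrite !inE hC orbT.
- by rewrite !inE eqxx.
Qed.

Theorem theorem1p5 :
  exists m0 : nat, forall m : nat, m0 <= m ->
  forall (T : finType) (E : {set {set T}}),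
    #|T| = 2 * m -> uniform (m - 1) E ->
  forall (l : nat) (x : 'I_l -> T) (h : 'I_l -> {set T}),
    berge_cycle E x h -> hamiltonian x ->
  forall f : {set T}, f \in E :\: cycle_edges h ->
    berge_pancyclic (f |: cycle_edges h).
Proof.
exists (40 * 144) => m m_large T E cardT unifE l x h C ham f.
rewrite inE => /andP[fC fE] k /andP[k2 kn].
have l_n : l = 2 * m.
  have x_surj : codom x =i T by move=> u; have [i <-] := ham u; rewrite codom_f.
  by rewrite -cardT -(card_ord l) -(card_codom (berge_vertices_inj C)) (eq_card x_surj).
have hC i : h i \in f |: cycle_edges h by rewrite !inE imset_f ?orbT.
have [kl|kl] := eqVneq k l.
  by subst k; exists x, h; case: C => *; split.
have unif' : uniform (m - 1) (f |: cycle_edges h).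
  move=> g; rewrite !inE => /predU1P[->|/imsetP[i _ ->]]; apply: unifE => //.
  exact: (berge_edges_mem C).
have [v [e hp]] := ham_plus_of_cycle C fC.
have -> : k = k.-1.+1 by case: k k2 {kn kl}.
apply: NNPP => no_cycle.
apply: (missing_length_false _ _ _ unif' _ _ no_cycle hp m_large) => //.
- by apply: leq_trans m_large.
- by rewrite cardT.
- by case: k k2 {kn kl no_cycle} => [|[]].
- by move: kn kl k2; rewrite cardT l_n; clear; lia.
Qed.
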